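(* There are constants $\eta_{\pi,\varrho}$ (depending only on the partition $\pi$ and on $\varrho\in(0,1]$) and $\widetilde\eta_{n,\varrho}$ (depending only on $n$ and $\varrho$), with $0\le\eta_{\pi,\varrho}<\widetilde\eta_{n,\varrho}<1$ for every partition $\pi$ of $n$, such that the following holds. Let $\pi=(n_1,\ldots,n_m)$ be a partition of $n$, let $\mathcal{O}\in\bar{\mathcal{B}}_c^{(m)}$, and let $A$ be a real symmetric matrix of order $n$ partitioned into blocks according to $\pi$. Let $A'$ be obtained from $A$ by applying one sweep of the quasi-cyclic block Jacobi method defined by the strategy $I_{\mathcal{O}}$. If all transformation matrices are from the class $\mathrm{UBCE}_\pi(\varrho)$, then $$S^2(A')\leq\eta_{\pi,\varrho}\,S^2(A),\qquad 0\leq\eta_{\pi,\varrho}<\widetilde{\eta}_{n,\varrho}<1 .$$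
   Context: **Partitions and blocks.** A partition $\pi=(n_1,\ldots,n_m)$ of $n$ ($m\ge 2$) is a tuple of positive integers with $n_1+\cdots+n_m=n$ (order matters). An $n\times n$ matrix is viewed as a block matrix $A=(A_{rs})$ with $A_{rs}$ of size $n_r\times n_s$. For symmetric $A=(a_{st})$, $S(A)=\big(\sum_{s<t}|a_{st}|^2\big)^{1/2}$ (sum over all strictly upper-triangular elements). **Elementary block matrices, UBCE.** For $1\le i<j\le m$ and $\widehat U=\begin{bmatrix} U_{ii} & U_{ij} \\ U_{ji} & U_{jj} \end{bmatrix}$ of order $n_i+n_j$, $\mathcal E(i,j,\widehat U)$ is the $n\times n$ matrix equal to $I_n$ except that its blocks at positions $(i,i),(i,j),(j,i),(j,j)$ are $U_{ii},U_{ij},U_{ji},U_{jj}$; $(i,j)$ is its pivot pair. For $0<\varrho\le1$, an orthogonal elementary block matrix $\mathcal E(i,j,\widehat U)$ is in $\mathrm{UBCE}_\pi(\varrho)$ if $\sigma_{\min}(U_{ii})=\sigma_{\min}(U_{jj})\ge\varrho\,\gamma_{ij}$, where $\gamma_{ij}=3/\sqrt{(4^{n_i}+6n_j-1)(n_j+1)}$. **Pivot sequences.** $\mathcal P_m=\{(r,s):1\le r<s\le m\}$. For $\mathcal S\subseteq\mathcal P_m$, $\mathbf O(\mathcal S)$ is the set of finite sequences of elements of $\mathcal S$ containing every element of $\mathcal S$ at least once (for $\mathcal S=\emptyset$ only the empty sequence). For $\mathcal O=(i_0,j_0),\ldots,(i_{T-1},j_{T-1})\in\mathbf O(\mathcal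 P_m)$, $I_{\mathcal O}$ is the $T$-periodic strategy with $I_{\mathcal O}(k)=(i_{k\bmod T},j_{k\bmod T})$. **Block Jacobi method.** $A^{(0)}=A$, $A^{(k+1)}=U_k^TA^{(k)}U_k$, where $U_k$ (the transformation matrix) is an orthogonal elementary block matrix with pivot pair $(i,j)=I_{\mathcal O}(k)$ such that the pivot submatrix $\begin{bmatrix} A_{ii} & A_{ij} \\ A_{ji} & A_{jj} \end{bmatrix}$ of $A^{(k+1)}$ is diagonal. One sweep consists of $T$ steps, so $A'=A^{(T)}$. **The class.** $\bar{\mathcal B}_c^{(m)}$ is the set of all sequences $\mathcal O\in\mathbf O(\mathcal P_m)$ of the form $$(1,2),(\tau_3(1),3),(\tau_3(2),3),\mathcal Q_3,\ldots,(\tau_m(1),m),\ldots,(\tau_m(m-1),m),\mathcal Q_m,$$ where, for $3\le j\le m$, $\tau_j$ is a permutation of $\{1,\ldots,j-1\}$ and $\mathcal Q_j\in\mathbf O(\mathcal S_j)$ for some $\mathcal S_j\subseteq\mathcal P_j=\{(r,s):1\le r<s\le j\}$. *)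

(* Defs.v *)
From HB Require Import structures.
From mathcomp Require Import all_boot all_order all_algebra all_fingroup.
From mathcomp Require Import classical_sets reals.

Set Implicit Arguments.
Unset Strict Implicit.
Unset Printing Implicit Defensive.

Import Order.TTheory GRing.Theory Num.Theory.

Local Open Scope ring_scope.

(* Block indices 1, ..., m are shifted to the elements 0, ..., m-1 of 'I_m.
   A partition is an m-tuple p of block sizes, and a matrix of order
   n = \sum_i p_i is split into its blocks by submxblock. *)

Definition is_partition (m : nat) (p : m.-tuple nat) : bool :=
  (2 <= m)%N && all (leq 1) p.

Section Matrices.
Variable R : realType.

Definition offS (n : nat) (A : 'M[R]_n) : R :=
  Num.sqrt (\sum_(s < n) \sum_(t < n | (s < t)%N) `|A s t| ^+ 2).

Definition singular_values (n : nat) (M : 'M[R]_n) : set R :=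
  [set x | exists2 a, eigenvalue (M^T *m M) a & x = Num.sqrt a]%classic.

(* For n > 0 the set is finite and nonempty, so that inf is its minimum. *)
Definition sigma_min (n : nat) (M : 'M[R]_n) : R := inf (singular_values M).

Definition orthogonal_mx (n : nat) (U : 'M[R]_n) : Prop := U^T *m U = 1%:M.

Section Blocks.
Variables (m : nat) (p : 'I_m -> nat).
Local Notation n := (\sum_(r < m) p r)%N.

(* conform_mx only casts a block of Uhat along p r = p i, p r = p j, ...;
   the dimensions always agree in the branch where it is used. *)
Definition elem_block (i j : 'I_m) (Uhat : 'M[R]_(p i + p j)) : 'M[R]_n :=
  \mxblock_(r < m, s < m)
    let I_rs := submxblock (1%:M : 'M[R]_n) r s in
    if (r == i) && (s == i) then conform_mx I_rs (ulsubmx Uhat)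
    else if (r == i) && (s == j) then conform_mx I_rs (ursubmx Uhat)
    else if (r == j) && (s == i) then conform_mx I_rs (dlsubmx Uhat)
    else if (r == j) && (s == j) then conform_mx I_rs (drsubmx Uhat)
    else I_rs.

Definition orth_elem_block (i j : 'I_m) (U : 'M[R]_n) : Prop :=
  (i < j)%N /\
  exists2 Uhat : 'M[R]_(p i + p j), U = elem_block Uhat & orthogonal_mx U.

Definition gamma (i j : 'I_m) : R :=
  3 / Num.sqrt ((4 ^+ p i + 6 * (p j)%:R - 1) * ((p j)%:R + 1)).

(* UBCE rho i j U: U belongs to the class, with pivot pair (i, j). *)
Definition UBCE (rho : R) (i j : 'I_m) (U : 'M[R]_n) : Prop :=
  (i < j)%N /\
  exists Uhat : 'M[R]_(p i + p j),
    [/\ U = elem_block Uhat,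
        orthogonal_mx U,
        sigma_min (ulsubmx Uhat) = sigma_min (drsubmx Uhat) &
        rho * gamma i j <= sigma_min (ulsubmx Uhat)].

Definition pivot_submx (i j : 'I_m) (A : 'M[R]_n) : 'M[R]_(p i + p j) :=
  block_mx (submxblock A i i) (submxblock A i j)
           (submxblock A j i) (submxblock A j j).

Definition jacobi_step (i j : 'I_m) (U A A' : 'M[R]_n) : Prop :=
  [/\ orth_elem_block i j U,
      A' = U^T *m A *m U &
      is_diag_mx (pivot_submx i j A')].

End Blocks.
End Matrices.

Section Strategies.
Variable m : nat.

Definition pairs_below (b : nat) : {set 'I_m * 'I_m} :=
  [set rs : 'I_m * 'I_m | (rs.1 < rs.2 < b)%N].

(* s =i S: all terms of s lie in S and every element of S occurs in s. *)
Definition pivot_seq (S : {set 'I_m * 'I_m}) (s : seq ('I_m * 'I_m)) : Prop :=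
  s =i S.

(* The periodic strategy; None only for the empty sequence. *)
Definition strategy (s : seq ('I_m * 'I_m)) (k : nat) : option ('I_m * 'I_m) :=
  onth s (k %% size s).

(* With 0-based indices, the pairs (tau_j(k), j), k < j, for the column j. *)
Definition column (j : 'I_m) (tau : {perm 'I_j}) : seq ('I_m * 'I_m) :=
  [seq (widen_ord (ltnW (ltn_ord j)) (tau k), j) | k <- enum 'I_j].

Definition Bc (s : seq ('I_m * 'I_m)) : Prop :=
  pivot_seq (pairs_below m) s /\
  exists (i0 i1 : 'I_m) (tau : forall j : 'I_m, {perm 'I_j})
         (Q : 'I_m -> seq ('I_m * 'I_m)),
    [/\ i0 = 0%N :> nat, i1 = 1%N :> nat,
        forall j : 'I_m, (2 <= j)%N ->
          exists2 S : {set 'I_m * 'I_m},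
            S \subset pairs_below j.+1 & pivot_seq S (Q j) &
        s = (i0, i1) ::
            flatten [seq column (tau j) ++ Q j
                    | j <- [seq j : 'I_m <- enum 'I_m | (2 <= j)%N]]].

End Strategies.

Section Sweep.
Variables (R : realType) (m : nat) (p : 'I_m -> nat).
Local Notation n := (\sum_(r < m) p r)%N.

(* One sweep from Aseq 0 = A to A' = Aseq T, with transformations Useq k. *)
Definition jacobi_sweep (s : seq ('I_m * 'I_m)) (A : 'M[R]_n)
    (Useq Aseq : nat -> 'M[R]_n) (A' : 'M[R]_n) : Prop :=
  [/\ Aseq 0%N = A,
      forall k, (k < size s)%N ->
        exists i j, strategy s k = Some (i, j) /\
          jacobi_step i j (Useq k) (Aseq k) (Aseq k.+1) &
      A' = Aseq (size s)].

Definition sweep_in_UBCE (rho : R) (s : seq ('I_m * 'I_m))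
    (Useq : nat -> 'M[R]_n) : Prop :=
  forall k i j, (k < size s)%N -> strategy s k = Some (i, j) ->
    UBCE rho i j (Useq k).

End Sweep.

(* Main.v *)
Require Import Defs.
From mathcomp Require Import all_boot all_order all_algebra all_fingroup.
From mathcomp Require Import classical_sets reals.
From mathcomp Require Import fintype finset ring lra.

Set Implicit Arguments.
Unset Strict Implicit.
Unset Printing Implicit Defensive.

Import Order.TTheory GRing.Theory Num.Theory.

Local Open Scope ring_scope.

(** Induction on the block columns.  Each step lowers the squared off-norm by
    that of its pivot submatrix, so S^2 never increases on a leading block
    submatrix containing all the pivots; this disposes of the sequences Q_j,
    however long.  In the pass over column j, the pivot block (r, j) has been
    multiplied on the right by earlier blocks U_jj, which shrink its squared
    norm by at most a fixed factor, up to an error controlled by off-diagonal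
    blocks of the leading part.  By induction those are reduced by a fixed
    factor, so either the leading part already accounts for a definite share
    of S^2 or column j does, and in both cases a definite share is lost.  The
    resulting constant only depends on n and rho. *)

(** * Cauchy-Schwarz, least eigenvalues and smallest singular values *)

Lemma quadratic_ge0_discr (R : realFieldType) (a b c : R) : 0 <= c ->
  (forall s, 0 <= a + 2 * s * b + s ^+ 2 * c) -> b ^+ 2 <= a * c.
Proof.
move=> c_ge0 q_ge0; have [c0|c_neq0] := eqVneq c 0; last first.
  have := q_ge0 (- (b / c)).
  have -> : a + 2 * - (b / c) * b + (- (b / c)) ^+ 2 * c = a - b ^+ 2 / c by field.
  by rewrite subr_ge0 ler_pdivrMr ?lt0r ?c_neq0.
have [b0|b_neq0] := eqVneq b 0; first by rewrite b0 c0 mulr0 expr0n.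
(* For c = 0 and b nonzero the polynomial is affine in s, and this s gives it the value -1. *)
have := q_ge0 (- (a + 1) / (2 * b)); rewrite c0 mulr0 addr0.
have -> : a + 2 * (- (a + 1) / (2 * b)) * b = -1 by field.
by rewrite lerNr oppr0 ler10.
Qed.

Section LeastEigenvalue.
Variable R : realType.

Definition dotr (n : nat) (u v : 'rV[R]_n) : R := (u *m v^T) 0 0.

Lemma dotrE n (u v : 'rV[R]_n) : dotr u v = \sum_j u 0 j * v 0 j.
Proof. by rewrite /dotr mxE; apply: eq_bigr => j _; rewrite mxE. Qed.

Lemma dotrC n (u v : 'rV[R]_n) : dotr u v = dotr v u.
Proof. by rewrite !dotrE; apply: eq_bigr => j _; rewrite mulrC. Qed.

Lemma dotrDl n (u v w : 'rV[R]_n) : dotr (u + v) w = dotr u w + dotr v w.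
Proof. by rewrite /dotr mulmxDl mxE. Qed.

Lemma dotrZl n a (u w : 'rV[R]_n) : dotr (a *: u) w = a * dotr u w.
Proof. by rewrite /dotr -scalemxAl mxE. Qed.

Lemma dotrDr n (u v w : 'rV[R]_n) : dotr w (u + v) = dotr w u + dotr w v.
Proof. by rewrite dotrC dotrDl !(dotrC w). Qed.

Lemma dotrZr n a (u w : 'rV[R]_n) : dotr w (a *: u) = a * dotr w u.
Proof. by rewrite dotrC dotrZl (dotrC w). Qed.

Lemma dotr_mul n m (u : 'rV[R]_n) (M : 'M_(n, m)) v :
  dotr (u *m M) v = dotr u (v *m M^T).
Proof. by rewrite /dotr trmx_mul trmxK mulmxA. Qed.

Lemma dotr_ge0 n (u : 'rV[R]_n) : 0 <= dotr u u.
Proof. by rewrite dotrE sumr_ge0// => j _; rewrite -expr2 sqr_ge0. Qed.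

Lemma dotr_eq0 n (u : 'rV[R]_n) : (dotr u u == 0) = (u == 0).
Proof.
apply/eqP/eqP => [|->]; last by rewrite /dotr mul0mx mxE.
rewrite dotrE => /eqP; rewrite psumr_eq0; last by move=> j _; rewrite -expr2 sqr_ge0.
move=> /allP h; apply/rowP => j; rewrite mxE; apply/eqP.
by have := h j (mem_index_enum _); rewrite /= -expr2 sqrf_eq0.
Qed.

(** The form is nonnegative at every u + s v, so its discriminant in s is controlled; degenerate
    forms are allowed. *)
Lemma psd_cauchy_schwarz n (M : 'M[R]_n) (u v : 'rV[R]_n) :
  M^T = M -> (forall w : 'rV[R]_n, 0 <= dotr (w *m M) w) ->
  dotr (u *m M) v ^+ 2 <= dotr (u *m M) u * dotr (v *m M) v.
Proof.
move=> symM psd; apply: quadratic_ge0_discr => [|s]; first exact: psd.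
have := psd (u + s *: v).
rewrite mulmxDl -scalemxAl !(dotrDl, dotrDr, dotrZl, dotrZr).
rewrite (_ : dotr (v *m M) u = dotr (u *m M) v); last by rewrite dotr_mul symM dotrC.
by congr (_ <= _); ring.
Qed.

Lemma cauchy_schwarz n (u v : 'rV[R]_n) :
  dotr u v ^+ 2 <= dotr u u * dotr v v.
Proof.
have := @psd_cauchy_schwarz n 1%:M u v; rewrite !mulmx1; apply; first exact: trmx1.
by move=> w; rewrite mulmx1 dotr_ge0.
Qed.

(** The squared Frobenius norm serves as [C], by Cauchy-Schwarz on each column. *)
Lemma mulmx_bounded n m (M : 'M[R]_(n, m)) :
  exists2 C, 0 <= C & forall v : 'rV[R]_n, dotr (v *m M) (v *m M) <= C * dotr v v.
Proof.
exists (\sum_j dotr (col j M)^T (col j M)^T).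
  by rewrite sumr_ge0// => j _; rewrite dotr_ge0.
move=> v; rewrite dotrE mulr_suml; apply: ler_sum => j _.
have -> : (v *m M) 0 j = dotr v (col j M)^T.
  by rewrite dotrE mxE; apply: eq_bigr => i _; rewrite !mxE.
by rewrite -expr2 mulrC cauchy_schwarz.
Qed.

(** Put w = v M and q = <w, v>. Invertibility gives |v|^2 <= C1 |w|^2, and Cauchy-Schwarz for the
    form of M gives |w|^4 <= q <w M, w> <= (C2 + 1) q |w|^2. *)
Lemma psd_coercive n (M : 'M[R]_n) :
  M^T = M -> (forall w : 'rV[R]_n, 0 <= dotr (w *m M) w) -> M \in unitmx ->
  exists2 e, 0 < e & forall v : 'rV[R]_n, e * dotr v v <= dotr (v *m M) v.
Proof.
move=> symM psd unitM.
have [C1 C1_ge0 boundV] := mulmx_bounded (invmx M).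
have [C2 C2_ge0 boundM] := mulmx_bounded M.
(* The last 1 keeps [K] positive even if [C1] is 0. *)
pose K := C1 * (C2 + 1) + 1.
have K_gt0 : 0 < K by rewrite ltr_wpDl ?mulr_ge0 ?addr_ge0.
exists K^-1; first by rewrite invr_gt0.
move=> v; rewrite mulrC ler_pdivrMr//.
set w := v *m M; set q := dotr w v.
have q_ge0 : 0 <= q by exact: psd.
have v_le : dotr v v <= C1 * dotr w w.
  by have := boundV w; rewrite /w mulmxK.
(* Here [C2 + 1] bounds the square root of [C2]. *)
have qw_le : dotr (w *m M) w <= (C2 + 1) * dotr w w.
  rewrite -ler_sqr ?nnegrE ?mulr_ge0 ?addr_ge0 ?dotr_ge0 ?psd//.
  apply: le_trans (cauchy_schwarz _ _) _.
  have := ler_wpM2r (dotr_ge0 w) (boundM w); have := dotr_ge0 w.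
  by move: (dotr w w) (dotr _ _) => x y; nra.
have w_le : dotr w w <= (C2 + 1) * q.
  have [->|w_neq0] := eqVneq (dotr w w) 0; first by rewrite mulr_ge0 ?addr_ge0.
  have w_gt0 : 0 < dotr w w by rewrite lt0r w_neq0 dotr_ge0.
  have := psd_cauchy_schwarz v w symM psd; rewrite -/w -/q => h.
  rewrite -(ler_pM2r w_gt0) -expr2 (le_trans h)//.
  by rewrite mulrAC mulrC ler_wpM2r.
apply: le_trans v_le _; apply: le_trans (ler_wpM2l C1_ge0 w_le) _.
rewrite /K; nra.
Qed.

(* The supremum of the t such that M - t is positive semidefinite is an
   eigenvalue: if M minus it were invertible, it would be coercive and t
   could be increased. *)
Lemma least_eigenvalue n (M : 'M[R]_n) : (0 < n)%N -> M^T = M ->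
  exists2 t, eigenvalue M t &
    forall v : 'rV[R]_n, t * dotr v v <= dotr (v *m M) v.
Proof.
case: n M => // n M _ symM.
pose E := [set t : R | forall v : 'rV[R]_n.+1, t * dotr v v <= dotr (v *m M) v]%classic.
have [C C_ge0 boundM] := mulmx_bounded M.
have E0 : (E !=set0)%classic.
  exists (- (C + 1)) => v.
  have : dotr (v *m M) v ^+ 2 <= ((C + 1) * dotr v v) ^+ 2.
    apply: le_trans (cauchy_schwarz _ _) _.
    have := ler_wpM2r (dotr_ge0 v) (boundM v); have := dotr_ge0 v.
    by move: (dotr v v) (dotr _ _) => x y; nra.
  rewrite -real_normK ?num_real// ler_sqr ?nnegrE ?mulr_ge0 ?addr_ge0 ?dotr_ge0//.
  by rewrite mulNr ler_norml => /andP[].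
have Eub : has_ubound E.
  exists (dotr (delta_mx 0 0 *m M) (delta_mx 0 0)) => t /(_ (delta_mx 0 0)).
  rewrite (_ : dotr (delta_mx 0 0) (delta_mx 0 0) = 1) ?mulr1//.
  by rewrite dotrE (bigD1 0)//= big1 ?mxE ?eqxx ?mulr1 ?addr0// => j j_neq0;
    rewrite mxE (negPf j_neq0) andbF mulr0.
pose t := sup E.
have tE v : t * dotr v v <= dotr (v *m M) v.
  have [/eqP|v_neq0] := eqVneq (dotr v v) 0.
    by rewrite dotr_eq0 => /eqP ->; rewrite mul0mx /dotr !mul0mx !mxE mulr0.
  have v_gt0 : 0 < dotr v v by rewrite lt0r v_neq0 dotr_ge0.
  rewrite -ler_pdivlMr//; apply: ge_sup => // s /(_ v).
  by rewrite ler_pdivlMr.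
exists t => //; rewrite /eigenvalue; apply/negP => ker0.
pose M' := M - t%:M.
have M'E (v : 'rV[R]_n.+1) : dotr (v *m M') v = dotr (v *m M) v - t * dotr v v.
  by rewrite mulmxBr mul_mx_scalar dotrDl -scaleNr dotrZl mulNr.
have [||| e e_gt0 coer] := @psd_coercive _ M'.
- by rewrite /M' linearB /= symM tr_scalar_mx.
- by move=> w; rewrite M'E subr_ge0.
- by rewrite -row_free_unit -kermx_eq0.
have : t + e <= t.
  apply: ub_le_sup => // v; have := coer v.
  by rewrite M'E mulrDl lerBrDl.
by rewrite gerDl leNgt e_gt0.
Qed.

(** For t nonzero an eigenvector v yields the eigenvector v U; for t = 0 both products are singular
    exactly when U is. *)
Lemma eigenvalue_mulmx_tr n (U : 'M[R]_n) t :
  eigenvalue (U *m U^T) t -> eigenvalue (U^T *m U) t.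
Proof.
have [->|t_neq0] := eqVneq t 0; last first.
  move=> /eigenvalueP[v vE v_neq0]; apply/eigenvalueP; exists (v *m U).
    by rewrite !mulmxA -(mulmxA v) vE -scalemxAl.
  apply: contra_neq v_neq0 => vU0; apply: (scalerI t_neq0).
  by rewrite scaler0 -vE mulmxA vU0 mul0mx.
by rewrite /eigenvalue /eigenspace raddf0 !subr0 !kermx_eq0 !row_free_unit
  !unitmx_mul andbC.
Qed.

(** |v U|^2 is the quadratic form of U U^T at v. Its least eigenvalue t is also an eigenvalue of U^T
    U, so sqrt t is a singular value and is at least c. *)
Lemma sigma_min_mulmx n (U : 'M[R]_n) (c : R) (v : 'rV[R]_n) :
  0 <= c <= sigma_min U -> c ^+ 2 * dotr v v <= dotr (v *m U) (v *m U).
Proof.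
(* In order 0 there are no singular values, but both norms are empty sums. *)
case: n U v => [|n] U v /andP[c_ge0 c_le].
  by rewrite !dotrE !big_ord0 mulr0.
have [] := @least_eigenvalue _ (U *m U^T) isT; first by rewrite trmx_mul trmxK.
move=> t eig_t bound_t.
have t_ge0 : 0 <= t.
  have /eigenvalueP[w wE w_neq0] := eig_t.
  have w_gt0 : 0 < dotr w w by rewrite lt0r dotr_eq0 w_neq0 dotr_ge0.
  rewrite -(pmulr_lge0 _ w_gt0) -dotrZl -wE mulmxA dotr_mul trmxK; exact: dotr_ge0.
have ct : c ^+ 2 <= t.
  rewrite -[t]sqr_sqrtr// ler_sqr ?nnegrE ?sqrtr_ge0// (le_trans c_le)//.
  apply: ge_inf; last by exists t => //; exact: eigenvalue_mulmx_tr.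
  by exists 0 => x [a _ ->]; rewrite sqrtr_ge0.
apply: le_trans (ler_wpM2r (dotr_ge0 v) ct) _.
by apply: le_trans (bound_t v) _; rewrite mulmxA dotr_mul trmxK.
Qed.

End LeastEigenvalue.

(** * Squared norms of submatrices under orthogonal conjugation *)

Section SquaredNorms.
Variables (R : realType) (n : nat).
Implicit Types (A B U : 'M[R]_n) (K L P X Y : {set 'I_n}).

Definition nrm2 K L A : R := \sum_(s in K) \sum_(t in L) A s t ^+ 2.
(** Both triangles are counted, so that for symmetric [A] and the full index set this is twice the
    square of [offS A]. *)
Definition off2 K A : R := \sum_(s in K) \sum_(t in K | t != s) A s t ^+ 2.

Lemma nrm2_ge0 K L A : 0 <= nrm2 K L A.
Proof. by apply: sumr_ge0 => s _; apply: sumr_ge0 => t _; exact: sqr_ge0. Qed.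

Lemma off2_ge0 K A : 0 <= off2 K A.
Proof. by apply: sumr_ge0 => s _; apply: sumr_ge0 => t _; exact: sqr_ge0. Qed.

Lemma nrm2_tr K L A : nrm2 K L A^T = nrm2 L K A.
Proof.
rewrite /nrm2 exchange_big; apply: eq_bigr => s _; apply: eq_bigr => t _.
by rewrite mxE.
Qed.

Lemma nrm2_off2 K A : nrm2 K K A = off2 K A + \sum_(s in K) A s s ^+ 2.
Proof.
rewrite -big_split; apply: eq_bigr => s sK /=.
by rewrite (bigD1 s)//= addrC.
Qed.

Lemma nrm2U X Y L A : [disjoint X & Y] ->
  nrm2 (X :|: Y) L A = nrm2 X L A + nrm2 Y L A.
Proof. by move=> dXY; rewrite /nrm2 -bigU//=; apply: eq_bigl => s; rewrite inE. Qed.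

Lemma nrm2Ur X Y L A : [disjoint X & Y] ->
  nrm2 L (X :|: Y) A = nrm2 L X A + nrm2 L Y A.
Proof. by move=> dXY; rewrite -nrm2_tr nrm2U// !nrm2_tr. Qed.

Lemma off2U X Y A : [disjoint X & Y] ->
  off2 (X :|: Y) A = off2 X A + off2 Y A + nrm2 X Y A + nrm2 Y X A.
Proof.
move=> dXY; apply: (addIr (\sum_(s in X :|: Y) A s s ^+ 2)).
rewrite -nrm2_off2 nrm2U// !nrm2Ur// !nrm2_off2.
rewrite [in RHS](eq_bigl [predU X & Y]) => [|s]; last by rewrite !inE.
by rewrite bigU//=; ring.
Qed.

Definition supported P U :=
  forall s t, ~~ ((s \in P) && (t \in P)) -> U s t = (s == t)%:R.

(** A matrix supported on P mixes only indices in P, so an orthogonal one preserves norms over index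
    sets that contain P or avoid it. *)
Definition saturated P K := (P \subset K) || [disjoint P & K].

Section Conjugation.
Variables (P : {set 'I_n}) (U : 'M[R]_n).
Hypotheses (orthU : orthogonal_mx U) (suppU : supported P U).

Lemma orth_row_norm m (A : 'M[R]_(m, n)) s :
  \sum_t (A *m U) s t ^+ 2 = \sum_t A s t ^+ 2.
Proof.
have rowE (B : 'M[R]_(m, n)) : \sum_t B s t ^+ 2 = (B *m B^T) s s.
  by rewrite mxE; apply: eq_bigr => t _; rewrite mxE expr2.
by rewrite !rowE trmx_mul mulmxA -(mulmxA A) (mulmx1C orthU) mulmx1.
Qed.

Lemma mulmx_out m (A : 'M[R]_(m, n)) s t : t \notin P -> (A *m U) s t = A s t.
Proof.
move=> tP; rewrite mxE (bigD1 t)//= big1 => [|u ut].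
  by rewrite suppU ?(negPf tP) ?andbF// eqxx mulr1 addr0.
by rewrite suppU ?(negPf tP) ?andbF// (negPf ut) mulr0.
Qed.

Lemma nrm2_mulmx K L A : saturated P L -> nrm2 K L (A *m U) = nrm2 K L A.
Proof.
move=> satL; apply: eq_bigr => s _.
have out (X : {set 'I_n}) : [disjoint P & X] ->
    \sum_(t in X) (A *m U) s t ^+ 2 = \sum_(t in X) A s t ^+ 2.
  by move=> dPX; apply: eq_bigr => t tX; rewrite mulmx_out// (disjointFl dPX).
case/orP: satL => [PL|]; last exact: out.
have split B : \sum_t B s t ^+ 2 =
    \sum_(t in L) B s t ^+ 2 + \sum_(t in ~: L) B s t ^+ 2.
  by rewrite (bigID (mem L))/=; congr (_ + _); apply: eq_bigl => t; rewrite inE.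
have := orth_row_norm A s; rewrite !split (out (~: L)); first by move/addIr.
by rewrite disjoint_sym disjoints_subset setCS.
Qed.

Lemma nrm2_conj K L A : saturated P K -> saturated P L ->
  nrm2 K L (U^T *m A *m U) = nrm2 K L A.
Proof.
move=> satK satL; rewrite nrm2_mulmx// -nrm2_tr trmx_mul trmxK nrm2_mulmx//.
exact: nrm2_tr.
Qed.

Lemma conj_outl A s t : s \notin P -> (U^T *m A *m U) s t = (A *m U) s t.
Proof.
move=> sP; rewrite -mulmxA; set B := A *m U.
have -> : (U^T *m B) s t = (B^T *m U) t s by rewrite -[U in RHS]trmxK -trmx_mul [RHS]mxE.
by rewrite mulmx_out// mxE.
Qed.

Lemma conj_out A s t : s \notin P -> t \notin P -> (U^T *m A *m U) s t = A s t.
Proof. by move=> sP tP; rewrite conj_outl// mulmx_out. Qed.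

Lemma off2_conj_disjoint K A : [disjoint P & K] ->
  off2 K (U^T *m A *m U) = off2 K A.
Proof.
move=> dPK; apply: eq_bigr => s sK; apply: eq_bigr => t /andP[tK _].
by rewrite conj_out ?(disjointFl dPK).
Qed.

(** The full norms over K and over P are both preserved and the diagonal entries outside P do not
    move, so whatever leaves the off-diagonal part goes to the diagonal inside P. *)
Lemma off2_conj K A : P \subset K ->
  (forall s t, s \in P -> t \in P -> s != t -> (U^T *m A *m U) s t = 0) ->
  off2 K (U^T *m A *m U) = off2 K A - off2 P A.
Proof.
move=> PK diagP; set A' := U^T *m A *m U.
have nK : nrm2 K K A' = nrm2 K K A by rewrite nrm2_conj /saturated ?PK.
have nP : nrm2 P P A' = nrm2 P P A by rewrite nrm2_conj /saturated ?subxx.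
have off0 : off2 P A' = 0.
  apply: big1 => s sP; apply: big1 => t /andP[tP ts].
  by rewrite diagP 1?eq_sym// expr0n.
have split B : \sum_(s in K) B s s ^+ 2 =
    \sum_(s in P) B s s ^+ 2 + \sum_(s in K :\: P) B s s ^+ 2.
  rewrite (big_setID P)/=; congr (_ + _).
  by apply: eq_bigl => s; rewrite inE andb_idl// => /(subsetP PK).
have out : \sum_(s in K :\: P) A' s s ^+ 2 = \sum_(s in K :\: P) A s s ^+ 2.
  by apply: eq_bigr => s /setDP[_ sP]; rewrite conj_out.
move: nK nP; rewrite !nrm2_off2 off0 !split out; lra.
Qed.

(* Row by row, (a + b)^2 >= a^2 / 2 - b^2 with a the contribution of Y and b
   that of X. *)
Lemma nrm2_conj_ge (k : R) (X Y W : {set 'I_n}) A :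
  P = X :|: Y -> [disjoint X & Y] -> [disjoint P & W] ->
  (forall v : 'I_n -> R, 2 * k * \sum_(u in Y) v u ^+ 2 <=
     \sum_(t in Y) (\sum_(u in Y) v u * U u t) ^+ 2) ->
  k * nrm2 W Y A - nrm2 W X A <= nrm2 W Y (U^T *m A *m U).
Proof.
move=> PE dXY dPW coer; rewrite /nrm2 mulr_sumr -sumrB.
apply: ler_sum => s sW; have sP : s \notin P by rewrite (disjointFl dPW).
pose a t := \sum_(u in Y) A s u * U u t.
pose b t := \sum_(u in X) A s u * U u t.
have AUE t : t \in Y -> (U^T *m A *m U) s t = a t + b t.
  move=> tY; rewrite conj_outl// mxE (bigID (mem P))/= [X in _ + X]big1 ?addr0.
    rewrite PE (eq_bigl [predU X & Y]) => [|u]; last by rewrite !inE.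
    by rewrite bigU//= addrC.
  move=> u uP; rewrite suppU ?(negPf uP)//.
  case: eqVneq uP => [->|]; last by rewrite mulr0.
  by rewrite PE inE tY orbT.
have ab : 2^-1 * (\sum_(t in Y) a t ^+ 2) - \sum_(t in Y) b t ^+ 2 <=
    \sum_(t in Y) (U^T *m A *m U) s t ^+ 2.
  rewrite mulr_sumr -sumrB; apply: ler_sum => t tY; rewrite AUE//.
  (* Half of this square is (a + b)^2 - a^2 / 2 + b^2. *)
  have := sqr_ge0 (a t + 2 * b t); move: (a t) (b t) => x y; nra.
have b_le : \sum_(t in Y) b t ^+ 2 <= \sum_(t in X) A s t ^+ 2.
  (* The [b t] are entries of [B *m U], which has the norm of [B] since [U] is orthogonal. *)
  pose B : 'rV[R]_n := \row_u (if u \in X then A s u else 0).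
  have bE t : b t = (B *m U) 0 t.
    rewrite mxE /b big_mkcond; apply: eq_bigr => u _.
    by rewrite mxE; case: ifP => // _; rewrite mul0r.
  have -> : \sum_(t in X) A s t ^+ 2 = \sum_t B 0 t ^+ 2.
    rewrite big_mkcond; apply: eq_bigr => u _.
    by rewrite mxE; case: ifP => // _; rewrite expr0n.
  rewrite -orth_row_norm [leRHS](bigID (mem Y))/=
    (eq_bigr (fun t => (B *m U) 0 t ^+ 2)) => [|t _]; last by rewrite bE.
  by rewrite lerDl sumr_ge0// => t _; exact: sqr_ge0.
have : 2 * k * \sum_(u in Y) A s u ^+ 2 <= \sum_(t in Y) a t ^+ 2 := coer (A s).
lra.
Qed.

End Conjugation.
End SquaredNorms.

(** * Decrease of the off-norm along a run of rotations, column by column *)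

Section Runs.
Variables (R : realType) (n m : nat) (blk : 'I_n -> 'I_m) (k : R).
Hypothesis k01 : 0 <= k <= 1.
Implicit Types (A U : 'M[R]_n) (i j r : 'I_m) (Z : {set 'I_m}).

Local Notation bs Z := (blk @^-1: Z).

(* The last condition says |v U_jj|^2 >= 2 k |v|^2 for all v; this is the only
   way in which the class UBCE is used. *)
Definition rotation i j A A' := exists U,
  [/\ orthogonal_mx U, supported (bs [set i; j]) U, A' = U^T *m A *m U,
      forall s t, s \in bs [set i; j] -> t \in bs [set i; j] -> s != t ->
        A' s t = 0 &
      forall v : 'I_n -> R, 2 * k * \sum_(u in bs [set j]) v u ^+ 2 <=
        \sum_(t in bs [set j]) (\sum_(u in bs [set j]) v u * U u t) ^+ 2].

Fixpoint runs (s : seq ('I_m * 'I_m)) A A' : Prop :=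
  if s is q :: s' then exists2 B, rotation q.1 q.2 A B & runs s' B A'
  else A = A'.

Lemma runs_cat s1 s2 A A' :
  runs (s1 ++ s2) A A' -> exists2 B, runs s1 A B & runs s2 B A'.
Proof.
elim: s1 A => [|q s1 IH] A /=; first by exists A.
by move=> [B qAB /IH[C]]; exists C => //; exists B.
Qed.

Lemma rotation_sym i j A A' : rotation i j A A' -> A^T = A -> A'^T = A'.
Proof. by move=> [U [_ _ -> _ _]] symA; rewrite !trmx_mul trmxK symA mulmxA. Qed.

Lemma runs_sym s A A' : runs s A A' -> A^T = A -> A'^T = A'.
Proof.
elim: s A => [|q s IH] A /=; first by move=> ->.
by move=> [B qAB /IH{}IH] symA; apply: IH; exact: rotation_sym qAB symA.
Qed.

Lemma bs_disjoint Z1 Z2 : [disjoint Z1 & Z2] -> [disjoint bs Z1 & bs Z2].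
Proof.
rewrite -!setI_eq0 -preimsetI => /eqP ->; exact/eqP/preimset0.
Qed.

(** The pivots lie in Z: each step lowers the off-norm on Z by that of its pivot submatrix, leaves
    entries outside its pivot blocks alone, and is saturated for [Z1] and [Z2]. The length of [s]
    does not matter, which settles the sequences Q_j. *)
Lemma runs_inside Z s A A' : runs s A A' ->
  (forall q, q \in s -> (q.1 \in Z) && (q.2 \in Z)) ->
  [/\ off2 (bs Z) A' <= off2 (bs Z) A,
      forall Z', [disjoint Z & Z'] -> off2 (bs Z') A' = off2 (bs Z') A &
      forall Z1 Z2, Z \subset Z1 -> [disjoint Z & Z2] ->
        nrm2 (bs Z1) (bs Z2) A' = nrm2 (bs Z1) (bs Z2) A].
Proof.
elim: s A => [|q s IH] A /=; first by move=> ->.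
move=> [B [U [orthU suppU BE diagB _]] runB] sZ.
have [|off_le off_eq nrm_eq] := IH _ runB.
  by move=> q' q's; apply: sZ; rewrite inE q's orbT.
have /andP[q1Z q2Z] := sZ q (mem_head _ _).
have qZ : [set q.1; q.2] \subset Z by rewrite subUset !sub1set q1Z.
split=> [|Z' dZ|Z1 Z2 sZ1 dZ].
- rewrite (le_trans off_le)// BE (off2_conj orthU suppU) -?BE//; last exact: preimsetS.
  by rewrite gerBl off2_ge0.
- rewrite off_eq// BE (off2_conj_disjoint suppU)//.
  by apply: bs_disjoint; exact: disjointWl qZ dZ.
- rewrite nrm_eq// BE (nrm2_conj orthU suppU)// /saturated.
    by rewrite preimsetS ?(subset_trans qZ).
  by rewrite bs_disjoint ?orbT// (disjointWl qZ).
Qed.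

(** Induction on [rs]. Rotating (r, j) removes the off-norm of blocks r and j; block (r', j) of a
    later r' keeps a share k of its squared norm, up to the squared norm of block (r', r). These
    errors add up to at most the off-norm inside [rs], and each rotation costs one factor k. *)
Lemma column_pass j (rs : seq 'I_m) Z A A' :
  uniq rs -> j \notin rs -> A^T = A -> [set r in j :: rs] \subset Z ->
  runs [seq (r, j) | r <- rs] A A' ->
  off2 (bs Z) A' <= off2 (bs Z) A
    - (2 * k ^+ size rs * nrm2 (bs [set r in rs]) (bs [set j]) A
       + (rs != [::])%:R * off2 (bs [set j]) A - off2 (bs [set r in rs]) A).
Proof.
have /andP[k0 k1] := k01.
elim: rs A => [|r rs IH] A /=.
  move=> _ _ _ _ ->; rewrite /nrm2 big_pred0; last by move=> s; rewrite !inE.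
  by rewrite mulr0 mul0r !add0r opprK lerDl off2_ge0.
move=> /andP[r_rs uniq_rs]; rewrite inE negb_or => /andP[jr j_rs] symA sZ.
move=> [B rotB runB]; have symB := rotation_sym rotB symA.
have sZ' : [set r0 in j :: rs] \subset Z.
  apply: subset_trans sZ; apply/subsetP => x.
  by rewrite !inE => /orP[->|->]; rewrite ?orbT.
have := IH B uniq_rs j_rs symB sZ' runB.
case: rotB => U [orthU suppU BE diagB coer].
set V := bs [set r0 in rs]; set J := bs [set j]; set X := bs [set r].
have PE : bs [set r; j] = X :|: J by rewrite preimsetU.
have VE : bs [set r0 in r :: rs] = X :|: V.
  by apply/setP => s; rewrite !inE.
have dXJ : [disjoint X & J] by apply: bs_disjoint; rewrite disjoints1 inE eq_sym.
have dXV : [disjoint X & V] by apply: bs_disjoint; rewrite disjoints1 inE.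
have dPV : [disjoint bs [set r; j] & V].
  apply: bs_disjoint; rewrite disjoints_subset; apply/subsetP => x; rewrite !inE.
  by case/orP => /eqP ->.
have PZ : bs [set r; j] \subset bs Z.
  apply: preimsetS; apply: subset_trans sZ; apply/subsetP => x; rewrite !inE.
  by case/orP => ->; rewrite ?orbT.
have offB : off2 (bs Z) B = off2 (bs Z) A - off2 (bs [set r; j]) A.
  by rewrite BE (off2_conj orthU suppU)// -BE.
have offV : off2 V B = off2 V A by rewrite BE (off2_conj_disjoint suppU).
have nrmV : k * nrm2 V J A - nrm2 V X A <= nrm2 V J B.
  by rewrite BE; apply: (nrm2_conj_ge orthU suppU _ PE).
have symN K L : nrm2 K L A = nrm2 L K A by rewrite -nrm2_tr symA.
rewrite VE nrm2U// off2U// offB offV PE off2U// (symN J X) (symN X V) mul1r exprS.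
have := off2_ge0 J B; have := off2_ge0 X A.
have : 0 <= k ^+ size rs <= 1 by rewrite exprn_ge0// exprn_ile1.
have := nrm2_ge0 V J A; have := nrm2_ge0 V X A; have := nrm2_ge0 X J A.
move: nrmV; move: (nrm2 V J B) (nrm2 V J A) (nrm2 V X A) (nrm2 X J A) => a b c d.
(* The diagonal block j is credited to the first rotation alone; its later contribution is
   nonnegative and is discarded. *)
have : 0 <= (rs != [::])%:R * off2 J B by rewrite mulr_ge0 ?off2_ge0 ?ler0n.
move: (_ * off2 J B) (k ^+ size rs) => w q w_ge0 ab d0 c0 b0 /andP[q0 q1] x0 _ h.
apply: le_trans h _.
have := ler_wpM2l q0 ab.
have : q * c <= c by rewrite ler_piMl.
have : k * q * d <= d by rewrite ler_piMl// mulr_ile1.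
lra.
Qed.

Let below (b : nat) : {set 'I_m} := [set r : 'I_m | (r < b)%N].

(** The invariant between columns: the leading b block columns have lost the share d. Of a later
    column only the total norm above its diagonal block is tracked, because rotations of leading
    blocks mix its rows. *)
Definition reduced (d : R) (b : nat) A0 A :=
  [/\ off2 (bs (below b)) A <= (1 - d) * off2 (bs (below b)) A0,
      forall j : 'I_m, (b <= j)%N -> off2 (bs [set j]) A = off2 (bs [set j]) A0 &
      forall j : 'I_m, (b <= j)%N ->
        nrm2 (bs (below j)) (bs [set j]) A = nrm2 (bs (below j)) (bs [set j]) A0].

Lemma below_disjoint (b : nat) j : (b <= j)%N -> [disjoint below b & [set j]].
Proof. by move=> bj; rewrite disjoint_sym disjoints1 inE -leqNgt. Qed.

Lemma below_mono (b c : nat) : (b <= c)%N -> below b \subset below c.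
Proof. by move=> bc; apply/subsetP => r; rewrite !inE => /leq_trans; apply. Qed.

Lemma belowS j : below j.+1 = below j :|: [set j].
Proof. by apply/setP => r; rewrite !inE ltnS leq_eqVlt orbC. Qed.

Lemma runs_below (b : nat) s A A' :
  runs s A A' -> (forall q, q \in s -> q \in pairs_below m b) ->
  [/\ off2 (bs (below b)) A' <= off2 (bs (below b)) A,
      forall j : 'I_m, (b <= j)%N -> off2 (bs [set j]) A' = off2 (bs [set j]) A &
      forall j : 'I_m, (b <= j)%N ->
        nrm2 (bs (below j)) (bs [set j]) A' = nrm2 (bs (below j)) (bs [set j]) A].
Proof.
move=> runA sb; have [|off_le off_eq nrm_eq] := runs_inside (Z := below b) runA.
  move=> q /sb; rewrite !inE => /andP[q12 q2b].
  by rewrite q2b (ltn_trans q12).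
split=> // j bj; first by rewrite off_eq ?below_disjoint.
by rewrite nrm_eq ?below_disjoint ?below_mono.
Qed.

(* With x and y the parts of S^2 before the column pass that lie inside and
   outside the leading blocks, the pass removes at least max(0, K y - x) >=
   d (K y - x), where x <= (1 - d) X for the initial value X of x. *)
Lemma stage_reduced j (tau : {perm 'I_j}) (Q : seq ('I_m * 'I_m)) (d d' : R) A0 A A' :
  (0 < j)%N -> 0 <= d <= 1 -> d' <= d * d -> d' <= d * k ^+ m ->
  A0^T = A0 -> A^T = A ->
  (forall q, q \in Q -> q \in pairs_below m j.+1) ->
  reduced d j A0 A -> runs (column tau ++ Q) A A' -> reduced d' j.+1 A0 A'.
Proof.
have /andP[k0 k1] := k01.
move=> j_gt0 /andP[d0 d1] d'd d'K symA0 symA Qj [offA offJ nrmJ] /runs_cat[B runB runA'].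
have [offA' offJ' nrmJ'] := runs_below runA' Qj.
pose rs := [seq widen_ord (ltnW (ltn_ord j)) (tau x) | x <- enum 'I_j].
have colE : column tau = [seq (r, j) | r <- rs] by rewrite /rs -map_comp.
have colj q : q \in column tau -> q \in pairs_below m j.+1.
  by rewrite colE => /mapP[r /mapP[x _ ->] ->]; rewrite inE /= ltn_ord ltnS leqnn.
have [offB offJB nrmJB] := runs_below runB colj.
have uniq_rs : uniq rs.
  rewrite map_inj_uniq ?enum_uniq// => x y /(congr1 val) /= xy.
  by apply: (@perm_inj _ tau); exact: val_inj.
have rsE : [set r in rs] = below j.
  apply/setP => r; rewrite !inE; apply/mapP/idP => [[x _ ->] /=|rj]; first exact: ltn_ord.
  by exists (tau^-1 (Ordinal rj))%g; [rewrite mem_enum|apply: val_inj; rewrite /= permKV].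
have j_rs : j \notin rs.
  have : j \notin [set r in rs] by rewrite rsE inE ltnn.
  by rewrite inE.
have sZ : [set r in j :: rs] \subset below j.+1.
  apply/subsetP => r; rewrite !inE => /orP[/eqP ->|r_rs]; first exact: ltnSn.
  have : r \in [set r in rs] by rewrite inE.
  by rewrite rsE inE ltnS => /ltnW.
have size_rs : size rs = j by rewrite size_map size_enum_ord.
have rs_neq0 : rs != [::] by rewrite -size_eq0 size_rs -lt0n.
rewrite colE in runB.
have := column_pass uniq_rs j_rs symA sZ runB; rewrite rsE size_rs rs_neq0 mul1r => passB.
split; last first.
- by move=> i ij; rewrite nrmJ' ?nrmJB ?nrmJ// ltnW.
- by move=> i ij; rewrite offJ' ?offJB ?offJ// ltnW.
apply: le_trans offA' _.
have dJ : [disjoint bs (below j) & bs [set j]] by rewrite bs_disjoint ?below_disjoint.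
have symN (C : 'M[R]_n) : C^T = C ->
    nrm2 (bs [set j]) (bs (below j)) C = nrm2 (bs (below j)) (bs [set j]) C.
  by move=> symC; rewrite -nrm2_tr symC.
have offS (C : 'M[R]_n) : C^T = C -> off2 (bs (below j.+1)) C = off2 (bs (below j)) C +
    (off2 (bs [set j]) C + 2 * nrm2 (bs (below j)) (bs [set j]) C).
  by move=> symC; rewrite belowS preimsetU off2U// symN//; ring.
move: offB passB; rewrite (offS A)// (offS A0)// offJ// nrmJ//.
have := off2_ge0 (bs [set j]) A0; have := nrm2_ge0 (bs (below j)) (bs [set j]) A0.
have := off2_ge0 (bs (below j)) A0; move: offA.
move: (off2 _ B) (off2 (bs (below j)) A) (off2 (bs (below j)) A0).
move: (off2 _ A0) (nrm2 _ _ A0) => o N b x X xX X0 N0 o0 b1.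
(* The exponent m in place of j makes the bound the same for all columns. *)
have : k ^+ m <= k ^+ j by rewrite ler_wiXn2l// ltnW.
have : 0 <= k ^+ m by rewrite exprn_ge0.
have : k ^+ m <= 1 by rewrite exprn_ile1.
move: (k ^+ m) (k ^+ j) d'K => K K' d'K K1 K0 KK' b2.
have KN : K * (2 * N) <= K' * (2 * N) by rewrite ler_wpM2r// mulr_ge0.
have Ko : K * o <= o by rewrite ler_piMl.
have b3 : b <= x + (o + 2 * N) - (K * (o + 2 * N) - x) by lra.
have : 0 <= o + 2 * N by rewrite addr_ge0 ?mulr_ge0.
move: (o + 2 * N) b1 b3 => y b1 b3 y0.
have b4 : b <= x + y - d * (K * y - x).
  have := ler_wpM2l d0 b3; have : 0 <= 1 - d by rewrite subr_ge0.
  by move=> /ler_wpM2l/(_ _ _ b1); lra.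
(* The coefficients become 1 - d^2 for X and 1 - d K for y, whence the two conditions on d'. *)
have xX' : (1 + d) * x <= (1 + d) * ((1 - d) * X) by rewrite ler_wpM2l ?addr_ge0.
have := ler_wpM2r X0 d'd; have := ler_wpM2r y0 d'K.
lra.
Qed.

(** Each column squares the gain: with K = k^m, the numbers d_b = K^(2^b) satisfy d_{b+1} = d_b^2,
    which is at most d_b K since d_b <= K. These are the conditions for one stage. *)
Lemma flatten_reduced (tau : forall j : 'I_m, {perm 'I_j})
    (Q : 'I_m -> seq ('I_m * 'I_m)) (js : seq 'I_m) (b : nat)
    A0 A A' :
  (0 < b)%N -> map val js = iota b (size js) ->
  (forall j, j \in js -> forall q, q \in Q j -> q \in pairs_below m j.+1) ->
  A0^T = A0 -> A^T = A ->
  reduced ((k ^+ m) ^+ (2 ^ b)) b A0 A ->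
  runs (flatten [seq column (tau j) ++ Q j | j <- js]) A A' ->
  reduced ((k ^+ m) ^+ (2 ^ (b + size js))) (b + size js) A0 A'.
Proof.
have /andP[k0 k1] := k01.
have K0 : 0 <= k ^+ m by rewrite exprn_ge0.
have K1 : k ^+ m <= 1 by rewrite exprn_ile1.
move=> + + + symA0.
elim: js b A => [|j js IH] b A b0 /=; first by move=> _ _ _; rewrite addn0 => ? <-.
move=> [jb jsE] QP symA redA /runs_cat[B runB runA'].
rewrite addnS -addSn; apply: (IH b.+1) runA' => //.
- by move=> i i_js; apply: QP; rewrite inE i_js orbT.
- exact: runs_sym runB symA.
rewrite -jb in b0 redA *; apply: stage_reduced redA runB => //.
- by rewrite exprn_ge0// exprn_ile1.
- by rewrite expnS mul2n -addnn exprD.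
- by rewrite expnS mul2n -addnn exprD ler_wpM2l ?exprn_ge0// ler_iXnr// expn_gt0.
- by apply: QP; rewrite mem_head.
Qed.

(** The first pair starts the invariant at b = 2 and the other columns carry it to b = m, where the
    leading part is the whole matrix. *)
Lemma Bc_reduced s A A' : Bc s -> A^T = A -> runs s A A' ->
  off2 setT A' <= (1 - (k ^+ m) ^+ (2 ^ m)) * off2 setT A.
Proof.
have /andP[k0 k1] := k01.
move=> [_ [i0 [i1 [tau [Q [i0E i1E QP ->]]]]]] symA /= [B rotB runA'].
set js := [seq _ <- _ | _] in runA'.
have m_ge2 : (2 <= m)%N by have := ltn_ord i1; rewrite i1E.
have jsE : map val js = iota 2 (m - 2).
  rewrite /js -[X in map _ X](eq_filter (a1 := preim val (leq 2))) => [|//].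
  rewrite -filter_map val_enum_ord -{1}(subnKC m_ge2) iotaD filter_cat /= add0n.
  by apply/all_filterP/allP => x; rewrite mem_iota => /andP[].
have size_js : size js = (m - 2)%N by rewrite -(size_map val) jsE size_iota.
have symB := rotation_sym rotB symA.
have [||j j_js q||h _ _] := @flatten_reduced tau Q js 2 A B A' _ _ _ symA symB _ runA' => //.
- by rewrite jsE size_js.
- have : (2 <= j)%N by move: j_js; rewrite mem_filter => /andP[].
  by move=> /QP[S /subsetP SP QS]; rewrite QS => /SP.
(* The first rotation diagonalizes the leading two blocks, so there any gain up to 1 is reached. *)
- have runB : runs [:: (i0, i1)] A B by exists B.
  have [|_ offB nrmB] := runs_below (b := 2) runB.
    by move=> q; rewrite inE => /eqP ->; rewrite inE /= i0E i1E.
  split=> //; have -> : below 2 = [set i0; i1].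
    apply/setP => r; rewrite !inE -!val_eqE /= i0E i1E.
    by case: (val r) => [|[|]].
  case: rotB => U [_ _ _ diagB _].
  rewrite [leLHS]big1 => [|s0 s0P]; last first.
    by apply: big1 => t /andP[tP ts]; rewrite diagB 1?eq_sym// expr0n.
  by rewrite mulr_ge0 ?off2_ge0// subr_ge0 !exprn_ile1 ?exprn_ge0.
move: h; rewrite size_js subnKC//.
have -> : below m = [set: 'I_m] by apply/setP => r; rewrite !inE ltn_ord.
by rewrite preimsetT.
Qed.
End Runs.

(** * From block Jacobi sweeps to runs of rotations *)

Section Sweeps.
Variables (R : realType) (m : nat) (p : 'I_m -> nat).
Local Notation n := (\sum_(r < m) p r)%N.
Local Notation blk := (@tagnat.sig1 m p).
Implicit Types (i j : 'I_m) (U A : 'M[R]_n).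

Lemma sum_block j (F : 'I_n -> R) :
  \sum_(t in blk @^-1: [set j]) F t = \sum_(x < p j) F (tagnat.Rank j x).
Proof.
rewrite (reindex (@tagnat.rank m p)) /=; last by apply: onW_bij; exact: tagnat.rank_bij.
transitivity (\sum_(i | i == j) \sum_(x < p i) F (tagnat.Rank i x)); last first.
  by rewrite big_pred1_eq.
rewrite sig_big_dep; apply: eq_big => [q|q _]; last by rewrite tagnat.rankE.
by rewrite !inE /tagnat.sig1 tagnat.rankK andbT.
Qed.

Lemma elem_block_supported i j (Uhat : 'M[R]_(p i + p j)) :
  supported (blk @^-1: [set i; j]) (elem_block Uhat).
Proof.
move=> s t; rewrite !inE negb_and !negb_or => /orP[]/andP[/negPf ni /negPf nj];
  by rewrite /elem_block mxE ni nj ?andbF /= !mxE !tagnat.sig2K.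
Qed.

Lemma drsubmx_elem_block i j (Uhat : 'M[R]_(p i + p j)) x y : i != j ->
  elem_block Uhat (tagnat.Rank j x) (tagnat.Rank j y) = drsubmx Uhat x y.
Proof.
move=> ij; transitivity (submxblock (elem_block Uhat) j j x y); first by rewrite [RHS]mxE.
by rewrite /elem_block mxblockK eq_sym (negPf ij) eqxx /= conform_mx_id.
Qed.

Lemma pivot_diag i j A s t : is_diag_mx (pivot_submx i j A) ->
  s \in blk @^-1: [set i; j] -> t \in blk @^-1: [set i; j] -> s != t -> A s t = 0.
Proof.
move=> /is_diag_mxP diagA.
(* [g] maps a position in the pivot submatrix to its position in the full matrix. *)
pose g (a : 'I_(p i + p j)) : 'I_n :=
  match fintype.split a with inl x => tagnat.Rank i x | inr y => tagnat.Rank j y end.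
have gP u : u \in blk @^-1: [set i; j] -> exists a, u = g a.
  rewrite !inE -{3}[u]tagnat.sig2K; move: (tagnat.sig2 u).
  move: (tagnat.sig1 u) => r x /orP[]/eqP rE; subst r.
    by exists (lshift _ x); rewrite /g (unsplitK (inl x)).
  by exists (rshift _ x); rewrite /g (unsplitK (inr x)).
have pivotE a b : pivot_submx i j A a b = A (g a) (g b).
  rewrite /pivot_submx !mxE /g.
  by case: (fintype.split a) => x; rewrite !mxE;
    case: (fintype.split b) => y; rewrite !mxE.
move=> /gP[a ->] /gP[b ->] ab; rewrite -pivotE diagA//.
by apply: contraNneq ab => /val_inj ->.
Qed.

(** The rotation needs U_jj, whereas the lower bound in the class is stated for U_ii; the equality
    of their smallest singular values transfers it. *)
Lemma jacobi_step_rotation (rho k : R) i j U A A' :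
  0 <= rho * gamma R p i j -> 2 * k <= (rho * gamma R p i j) ^+ 2 ->
  UBCE rho i j U -> jacobi_step i j U A A' -> rotation blk k i j A A'.
Proof.
move=> c_ge0 k_le [ij [Uhat [UE orthU sigmaE sigma_le]]] [_ A'E diagA'].
have ij' : i != j by apply: contraTneq ij => ->; rewrite ltnn.
exists U; split=> //.
- rewrite UE; exact: elem_block_supported.
- by move=> s t; exact: pivot_diag.
move=> v; pose w : 'rV[R]_(p j) := \row_x v (tagnat.Rank j x).
have wE : \sum_(u in blk @^-1: [set j]) v u ^+ 2 = dotr w w.
  by rewrite sum_block dotrE; apply: eq_bigr => x _; rewrite !mxE expr2.
have wUE : \sum_(t in blk @^-1: [set j])
      (\sum_(u in blk @^-1: [set j]) v u * U u t) ^+ 2 =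
    dotr (w *m drsubmx Uhat) (w *m drsubmx Uhat).
  rewrite sum_block dotrE; apply: eq_bigr => x _; rewrite expr2 sum_block.
  suff -> : \sum_(y < p j) v (tagnat.Rank j y) * U (tagnat.Rank j y) (tagnat.Rank j x) =
    (w *m drsubmx Uhat) 0 x by [].
  by rewrite [RHS]mxE; apply: eq_bigr => y _; rewrite UE drsubmx_elem_block// [w 0 y]mxE.
rewrite wE wUE; apply: le_trans (ler_wpM2r (dotr_ge0 w) k_le) _.
by apply: sigma_min_mulmx; rewrite c_ge0 -sigmaE.
Qed.

Lemma sweep_runs (rho k : R) O A A' (Useq Aseq : nat -> 'M[R]_n) :
  (forall i j, 0 <= rho * gamma R p i j /\ 2 * k <= (rho * gamma R p i j) ^+ 2) ->
  jacobi_sweep O A Useq Aseq A' -> sweep_in_UBCE rho O Useq -> runs blk k O A A'.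
Proof.
move=> k_le [<- stepA ->] UBCE_U.
have stepE l : (l < size O)%N -> exists2 q, onth O l = Some q &
    rotation blk k q.1 q.2 (Aseq l) (Aseq l.+1).
  move=> lO; have [i [j [strE stepl]]] := stepA l lO.
  exists (i, j); first by rewrite -strE /strategy modn_small.
  have [c0 kc] := k_le i j.
  exact: jacobi_step_rotation c0 kc (UBCE_U l i j lO strE) stepl.
elim: O Aseq stepE {stepA UBCE_U} => // q s IH Aseq stepE.
have [_ [<-] rotq] := stepE 0%N isT; exists (Aseq 1%N) => //.
by apply: (IH (Aseq \o succn)) => l ls; exact: (stepE l.+1).
Qed.

End Sweeps.

(** * Explicit constants and the theorem *)

Lemma offS_sqr (R : realType) n (A : 'M[R]_n) : A^T = A ->
  2 * offS A ^+ 2 = off2 setT A.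
Proof.
move=> symA; rewrite sqr_sqrtr; last first.
  by apply: sumr_ge0 => s _; apply: sumr_ge0 => t _; exact: sqr_ge0.
have offE : \sum_(s < n) \sum_(t < n | (s < t)%N) `|A s t| ^+ 2 =
    \sum_(s < n) \sum_(t < n | (s < t)%N) A s t ^+ 2.
  by apply: eq_bigr => s _; apply: eq_bigr => t _; rewrite real_normK ?num_real.
rewrite offE mulrDl mul1r {2}(exchange_big_dep predT)//= -big_split /off2.
apply: eq_big => [s|s _]; first by rewrite inE.
rewrite [in RHS](bigID (fun t : 'I_n => s < t)%N)/=; congr (_ + _).
  by apply: eq_bigl => t; rewrite inE /= -val_eqE; case: ltngtP.
apply: eq_big => [t|t _]; first by rewrite inE /= -val_eqE; case: ltngtP.
by rewrite -[in LHS]symA mxE.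
Qed.

Section Constants.
Variable R : realType.

(** This is (k^m)^(2^m) with m replaced by n, where k is at most half of every (rho gamma_ij)^2.
    Bounding all block sizes by n removes the dependence on the partition. *)
Definition sweep_gain (n : nat) (rho : R) : R :=
  ((rho ^+ 2 / ((4 ^+ n + 6 * n%:R) * (n%:R + 1))) ^+ n) ^+ (2 ^ n).

Lemma gamma_sqr_ge (m : nat) (p : 'I_m -> nat) (n : nat) (i j : 'I_m) (rho : R) :
  0 <= rho -> (0 < p j)%N -> (p i <= n)%N -> (p j <= n)%N ->
  0 <= rho * gamma R p i j /\
  2 * (rho ^+ 2 / ((4 ^+ n + 6 * n%:R) * (n%:R + 1))) <= (rho * gamma R p i j) ^+ 2.
Proof.
move=> rho0 pj0 pin pjn; split.
  by rewrite mulr_ge0// divr_ge0 ?sqrtr_ge0.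
have qi : (4 : R) ^+ p i <= 4 ^+ n by rewrite ler_weXn2l// ler1n.
have qi0 : 0 < (4 : R) ^+ p i by rewrite exprn_gt0.
have pj1 : (1 : R) <= (p j)%:R by rewrite ler1n.
have pjn' : (p j)%:R <= n%:R :> R by rewrite ler_nat.
(* Positivity of [p j] makes the radicand nonnegative; the numerator 9 then absorbs the factor 2. *)
rewrite exprMn /gamma expr_div_n sqr_sqrtr; last by rewrite mulr_ge0//; lra.
rewrite mulrCA ler_wpM2l ?sqr_ge0//.
have den_gt0 : 0 < (4 ^+ p i + 6 * (p j)%:R - 1) * ((p j)%:R + 1) :> R.
  by rewrite mulr_gt0//; lra.
rewrite ler_pdivlMr// mulrAC ler_pdivrMr; last by rewrite mulr_gt0//; lra.
have : (4 ^+ p i + 6 * (p j)%:R - 1) * ((p j)%:R + 1) <=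
    (4 ^+ n + 6 * n%:R) * (n%:R + 1) :> R by apply: ler_pM; lra.
lra.
Qed.

End Constants.

Theorem theorem4p1 (R : realType) :
  exists (eta : seq nat -> R -> R) (eta_tilde : nat -> R -> R),
  forall (m : nat) (p : m.-tuple nat) (rho : R),
    is_partition p -> 0 < rho <= 1 ->
    [/\ 0 <= eta p rho,
        eta p rho < eta_tilde (\sum_(r < m) tnth p r)%N rho,
        eta_tilde (\sum_(r < m) tnth p r)%N rho < 1 &
        forall (O : seq ('I_m * 'I_m)) (A A' : 'M[R]_(\sum_(r < m) tnth p r))
               (Useq Aseq : nat -> 'M[R]_(\sum_(r < m) tnth p r)),
          Bc O ->
          A^T = A ->
          jacobi_sweep O A Useq Aseq A' ->
          sweep_in_UBCE rho O Useq ->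
          offS A' ^+ 2 <= eta p rho * offS A ^+ 2].
Proof.
exists (fun p rho => 1 - sweep_gain (sumn p) rho).
(* Half of the positive gain leaves room for both strict inequalities. *)
exists (fun n rho => 1 - sweep_gain n rho / 2).
move=> m p rho /andP[_ /all_tnthP p_gt0] /andP[rho0 rho1].
have -> : sumn p = (\sum_(r < m) tnth p r)%N by rewrite sumnE big_tuple.
have p_le r : (tnth p r <= \sum_(r < m) tnth p r)%N.
  by rewrite (bigD1 r)//= leq_addr.
(* Every block is nonempty. *)
have m_le : (m <= \sum_(r < m) tnth p r)%N.
  by rewrite -[m in (m <= _)%N]card_ord -sum1_card leq_sum.
rewrite /sweep_gain; set n := (\sum_(r < m) tnth p r)%N in p_le m_le *.
set k := rho ^+ 2 / _.
have den_ge1 : 1 <= (4 ^+ n + 6 * n%:R) * (n%:R + 1) :> R.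
  have := exprn_ege1 n (_ : 1 <= 4 :> R); rewrite ler1n => /(_ isT).
  have := ler0n R n; move: (4 ^+ n) n%:R => x y y0 x1.
  by rewrite -[1]mulr1 ler_pM//; lra.
have k_gt0 : 0 < k by rewrite divr_gt0 ?exprn_gt0// (lt_le_trans ltr01).
have k_le1 : k <= 1.
  rewrite ler_pdivrMr ?(lt_le_trans ltr01)// mul1r (le_trans _ den_ge1)//.
  by rewrite exprn_ile1// ltW.
have k_ge0 := ltW k_gt0.
have k01 : 0 <= k <= 1 by rewrite k_ge0.
have gain_gt0 : 0 < (k ^+ n) ^+ (2 ^ n) by rewrite !exprn_gt0.
have gain_le1 : (k ^+ n) ^+ (2 ^ n) <= 1 by rewrite !exprn_ile1 ?exprn_ge0.
split; [lra | lra | lra |].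
move=> O A A' Useq Aseq BcO symA sweepA UBCE_U.
have runA : runs (@tagnat.sig1 m (tnth p)) k O A A'.
  apply: sweep_runs sweepA UBCE_U => i j.
  by apply: gamma_sqr_ge (p_le i) (p_le j); [exact: ltW | exact: p_gt0].
rewrite -(ler_pM2l (ltr0Sn R 1)) [leRHS]mulrCA !offS_sqr//;
  last exact: runs_sym runA symA.
apply: le_trans (Bc_reduced k01 BcO symA runA) _.
(* As k <= 1, raising the exponent from m 2^m to n 2^n only lowers the gain. *)
rewrite ler_wpM2r ?off2_ge0// lerD2l lerN2 -!exprM ler_wiXn2l//.
by rewrite leq_mul// leq_exp2l.
Qed.
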